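(* Let $a>0$, let $\bar\omega_h^{\,0}$ be a fixed mesh on $[0,X]$ with nodes $0=x_0^0<\dots<x_{N_0}^0=X$, $N_0\geq 2$, and mean step $h_{\omega^0}=X/N_0$, and let $\lambda^{(0)}=\lambda_R^{(0)}+\mathrm{i}\lambda_I^{(0)}\in\mathbb{C}$ be an eigenvalue of the mesh eigenvalue problem $-\Lambda e=\lambda s_Ne$ on $\omega_h$, $e\in H_h$, $e\not\equiv0$, for $\bar\omega_h=\bar\omega_h^{\,0}$. Let $\varkappa\geq 0$. For $K\geq 1$ let $\bar\omega_h=\bar\omega_h^{\,0,K}$ be the refined mesh described in the context, with mean step $h_\omega=h_{\omega^0}/K$. For the validity on the mesh $\bar\omega_h^{\,0,K}$, with some constant $C>0$, of the stability bound $$\|v^m\|_h\leq C(1+\varkappa\tau)^m\big(\|v^0\|_h+\|u_{1N}\|_{1h}\big)\quad\text{for any } v^0,u_{1N}\in H_h,\ m\geq 0,$$ for the solutions $v$ of the compact scheme (described in the context) with data $v^0,u_{1N}$, where $\|\cdot\|_h$ and $\|\cdot\|_{1h}$ are any fixed norms on $H_h$, the following condition is necessary: $$a^2|\lambda_I^{(0)}|\,h_{\omega^0}^2\,\frac{\tau}{h_\omega^2}\leq\frac92\varkappa+O(\tau)\quad\text{as }\tau\to0,$$ where the $O(\tau)$ term depends only on $\varkappa$ and $\tau$ (not on $K$, $C$ or the norms).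
   Context: Mesh and operators. Let $X>0$, $N\geq 2$, and let $\bar\omega_h$ be a (generally non-uniform) mesh on $[0,X]$ with nodes $0=x_0<\dots<x_N=X$ and steps $h_j=x_j-x_{j-1}$, $1\le j\le N$; $\omega_h=\{x_j\}_{j=1}^{N-1}$. Let $H_h$ be the complex vector space of functions $w:\bar\omega_h\to\mathbb{C}$, $w_j=w(x_j)$, with $w_0=w_N=0$. For $1\leq j\leq N-1$ put $\hat h_j=\frac{h_j+h_{j+1}}{2}$ and $$(\Lambda w)_j=\frac{1}{\hat h_j}\Big(\frac{w_{j+1}-w_j}{h_{j+1}}-\frac{w_j-w_{j-1}}{h_j}\Big),\qquad (s_Nw)_j=\frac1{12}\big(\alpha_{hj}w_{j-1}+10\gamma_{hj}w_j+\beta_{hj}w_{j+1}\big),$$ $$\alpha_{hj}=2-\frac{h_{j+1}^2}{h_j\hat h_j},\qquad \gamma_{hj}=1+\frac{(h_{j+1}-h_j)^2}{5h_jh_{j+1}},\qquad \beta_{hj}=2-\frac{h_j^2}{h_{j+1}\hat h_j}.$$ Scheme. Let $a>0$, $\tau>0$, $\sigma=\frac1{12}$. For given data $v^0\in H_h$ and $u_{1N}\in H_h$ (treated as arbitrary data), a solution is a sequence $v^m\in H_h$, $m\geq 0$, starting with the given $v^0$, such that $$(s_N-\sigma\tau^2a^2\Lambda)\frac{v^{m+1}-2v^m+v^{m-1}}{\tau^2}-a^2\Lambda v^m=0\ \text{ on }\omega_h,\ m\geq 1,$$ $$(s_N-\sigma\tau^2a^2\Lambda)\frac{v^1-v^0}{\tau}-\frac{\tau}{2}a^2\Lambda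 v^0=u_{1N}\ \text{ on }\omega_h.$$ Refined meshes. Given the mesh $\bar\omega_h^{\,0}$ with nodes $0=x_0^0<\dots<x_{N_0}^0=X$ and an integer $K\geq1$, the mesh $\bar\omega_h^{\,0,K}$ on $[0,X]$ has $N=N_0K$ and nodes, for $0\leq l\leq N_0-1$, $$x_{2kN_0+l}=2k\frac XK+\frac{x_l^0}{K}\ \ (0\leq 2k<K),\qquad x_{(2k-1)N_0+l}=2k\frac XK-\frac{x_{N_0-l}^0}{K}\ \ (1\leq 2k-1<K),\qquad x_N=X,$$ with $k$ an integer; its mean step is $h_\omega=X/N=h_{\omega^0}/K$. *)

(* Defs.v *)
From HB Require Import structures.
From mathcomp Require Import all_boot all_order all_algebra.
From mathcomp Require Import all_classical all_reals all_analysis.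
From mathcomp Require Import complex.
Set Implicit Arguments.
Unset Strict Implicit.
Unset Printing Implicit Defensive.
Import Order.TTheory GRing.Theory Num.Theory.
Import numFieldNormedType.Exports.
Local Open Scope ring_scope.
Local Open Scope complex_scope.

(* A mesh with N steps is given by its nodes x : nat -> R; only
   x 0, ..., x N are meaningful. *)
Definition is_mesh (R : realType) (X : R) (N : nat) (x : nat -> R) : Prop :=
  [/\ x 0%N = 0, x N = X & forall j : nat, (j < N)%N -> x j < x j.+1].

(* step x j = x_j - x_{j-1}, for j >= 1 *)
Definition step (R : realType) (x : nat -> R) (j : nat) : R := x j - x j.-1.

Definition hat_step (R : realType) (x : nat -> R) (j : nat) : R :=
  (step x j + step x j.+1) / 2.

Definition mean_step (R : realType) (X : R) (N : nat) : R := X / N%:R.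

(* A mesh function w_0, ..., w_N is a row vector of length N + 1; the space
   H_h is the type of those with w_0 = w_N = 0, with the complex vector space
   structure inherited from row vectors. *)
Definition vanishing_ends (R : realType) (N : nat) : {pred 'rV[R[i]]_N.+1} :=
  [pred w : 'rV[R[i]]_N.+1 | (w ord0 ord0 == 0) && (w ord0 ord_max == 0)].

Lemma vanishing_ends_submod (R : realType) (N : nat) :
  submod_closed (@vanishing_ends R N).
Proof.
split=> [|c u v]; first by rewrite inE !mxE eqxx.
rewrite !inE => /andP[/eqP u0 /eqP uN] /andP[/eqP v0 /eqP vN].
by rewrite !mxE u0 uN v0 vN mulr0 addr0 eqxx.
Qed.

HB.instance Definition _ (R : realType) (N : nat) :=
  GRing.isSubmodClosed.Build R[i] 'rV[R[i]]_N.+1 (@vanishing_ends R N)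
    (@vanishing_ends_submod R N).

Record Hh (R : realType) (N : nat) : Type := MkHh {
  Hh_val : 'rV[R[i]]_N.+1;
  Hh_valP : Hh_val \in @vanishing_ends R N }.

HB.instance Definition _ (R : realType) (N : nat) :=
  [isSub for @Hh_val R N].
HB.instance Definition _ (R : realType) (N : nat) :=
  [Choice of Hh R N by <:].
HB.instance Definition _ (R : realType) (N : nat) :=
  [SubChoice_isSubLmodule of Hh R N by <:].

(* w_j, for 0 <= j <= N; inord sends larger j to 0. *)
Definition at_node (R : realType) (N : nat) (w : Hh R N) (j : nat) : R[i] :=
  Hh_val w ord0 (inord j).

Definition is_norm (R : realType) (N : nat) (n : Hh R N -> R) : Prop :=
  [/\ forall w, 0 <= n w,
      forall w, n w = 0 -> w = 0,
      forall (c : R[i]) w, (n (c *: w))%:C = `|c| * (n w)%:C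
    & forall w z, n (w + z) <= n w + n z].

(* The operators below are meaningful at the interior nodes 0 < j < N. *)
Definition Lambda (R : realType) (x : nat -> R) (N : nat) (w : Hh R N)
    (j : nat) : R[i] :=
  (hat_step x j)^-1%:C *
    ((at_node w j.+1 - at_node w j) / (step x j.+1)%:C
     - (at_node w j - at_node w j.-1) / (step x j)%:C).

Definition alpha (R : realType) (x : nat -> R) (j : nat) : R :=
  2 - step x j.+1 ^+ 2 / (step x j * hat_step x j).

Definition gamma (R : realType) (x : nat -> R) (j : nat) : R :=
  1 + (step x j.+1 - step x j) ^+ 2 / (5 * step x j * step x j.+1).

Definition beta (R : realType) (x : nat -> R) (j : nat) : R :=
  2 - step x j ^+ 2 / (step x j.+1 * hat_step x j).

Definition sN (R : realType) (x : nat -> R) (N : nat) (w : Hh R N)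
    (j : nat) : R[i] :=
  12^-1 * ((alpha x j)%:C * at_node w j.-1
           + 10 * (gamma x j)%:C * at_node w j
           + (beta x j)%:C * at_node w j.+1).

Definition is_eigenvalue (R : realType) (x : nat -> R) (N : nat)
    (lambda : R[i]) : Prop :=
  exists2 e : Hh R N, e != 0 &
    forall j : nat, (0 < j < N)%N -> - Lambda x e j = lambda * sN x e j.

Definition sigma (R : realType) : R := 12^-1.

Definition implicit_op (R : realType) (a tau : R) (x : nat -> R) (N : nat)
    (w : Hh R N) (j : nat) : R[i] :=
  sN x w j - (sigma R * tau ^+ 2 * a ^+ 2)%:C * Lambda x w j.

Definition is_solution (R : realType) (a tau : R) (x : nat -> R) (N : nat)
    (v0 u1 : Hh R N) (v : nat -> Hh R N) : Prop :=
  [/\ v 0%N = v0,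
      forall m j : nat, (1 <= m)%N -> (0 < j < N)%N ->
        implicit_op a tau x
          ((tau ^+ 2)^-1%:C *: (v m.+1 - 2 *: v m + v m.-1)) j
        - (a ^+ 2)%:C * Lambda x (v m) j = 0
    & forall j : nat, (0 < j < N)%N ->
        implicit_op a tau x (tau^-1%:C *: (v 1%N - v 0%N)) j
        - (tau / 2 * a ^+ 2)%:C * Lambda x (v 0%N) j = at_node u1 j].

Definition stability_bound (R : realType) (a tau kappa : R) (x : nat -> R)
    (N : nat) (norm_h norm_1h : Hh R N -> R) (C : R) : Prop :=
  forall (v0 u1 : Hh R N) (v : nat -> Hh R N),
    is_solution a tau x v0 u1 v ->
    forall m : nat,
      norm_h (v m) <= C * (1 + kappa * tau) ^+ m * (norm_h v0 + norm_1h u1).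

(* Nodes of the refined mesh, the index being written j = q * N0 + l with
   l < N0: for even q = 2k the scaled mesh is translated to 2k X / K, for odd
   q = 2k - 1 it is reflected about 2k X / K. *)
Definition refined_mesh (R : realType) (X : R) (N0 : nat) (x0 : nat -> R)
    (K : nat) (j : nat) : R :=
  let q := (j %/ N0)%N in
  let l := (j %% N0)%N in
  if j == (N0 * K)%N then X
  else if odd q then q.+1%:R * (X / K%:R) - x0 (N0 - l)%N / K%:R
  else q%:R * (X / K%:R) + x0 l / K%:R.

(* Main.v *)
(* An eigenfunction on the initial mesh, extended oddly through the ends of the
   K blocks, is an eigenfunction on the refined mesh with the eigenvalue
   lambda = K^2 lambda0: at a junction of two blocks the mesh is symmetric and
   the function odd, so both difference operators vanish there.
   For such e the sequence q^m e solves the scheme (with suitable u1) as soon as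
   q + 1/q = 2 - z / (1 + z / 12), z = tau^2 a^2 lambda, that is, when
   (z + 12) (10 + q + 1/q) = 144.  The bound forces |q|, |1/q| <= 1 + t with
   t = kappa tau, so that |Im (q + 1/q)| <= 2 t and Re (q + 1/q) >= -(2 + t^2),
   whence |Im z| <= 288 t / (8 - t^2)^2 <= 9/2 (t + t^2) for t <= 1. *)
Require Import Defs.
From mathcomp Require Import all_boot all_order all_algebra.
From mathcomp Require Import all_classical all_reals all_analysis.
From mathcomp Require Import complex.
From mathcomp Require Import ring lra zify.
Set Implicit Arguments.
Unset Strict Implicit.
Unset Printing Implicit Defensive.
Import Order.TTheory GRing.Theory Num.Theory.
Import numFieldNormedType.Exports.
Local Open Scope classical_set_scope.
Local Open Scope ring_scope.
Local Open Scope complex_scope.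

(** * Three-point stencils as functions of two steps and three values *)

Definition laplace3 (R : realType) (hl hr : R) (fl fc fr : R[i]) : R[i] :=
  ((hl + hr) / 2)^-1%:C * ((fr - fc) / hr%:C - (fc - fl) / hl%:C).

Definition numerov3 (R : realType) (hl hr : R) (fl fc fr : R[i]) : R[i] :=
  12^-1 * ((2 - hr ^+ 2 / (hl * ((hl + hr) / 2)))%:C * fl
           + 10 * (1 + (hr - hl) ^+ 2 / (5 * hl * hr))%:C * fc
           + (2 - hl ^+ 2 / (hr * ((hl + hr) / 2)))%:C * fr).

Section ThreePoint.
Variable R : realType.
Implicit Types (h hl hr c : R) (f fl fc fr : R[i]).

Lemma LambdaE (x : nat -> R) N (w : Hh R N) j : Lambda x w j =
  laplace3 (step x j) (step x j.+1) (at_node w j.-1) (at_node w j)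
    (at_node w j.+1).
Proof. by []. Qed.

Lemma sNE (x : nat -> R) N (w : Hh R N) j : sN x w j =
  numerov3 (step x j) (step x j.+1) (at_node w j.-1) (at_node w j)
    (at_node w j.+1).
Proof. by []. Qed.

(** Invariance under reflection, for the odd blocks, where the initial mesh is traversed
    backwards. *)
Lemma laplace3_swap hl hr fl fc fr :
  laplace3 hr hl fr fc fl = laplace3 hl hr fl fc fr.
Proof. rewrite /laplace3 (addrC hr hl); ring. Qed.

Lemma numerov3_swap hl hr fl fc fr :
  numerov3 hr hl fr fc fl = numerov3 hl hr fl fc fr.
Proof.
rewrite /numerov3 (addrC hr hl) (_ : (hl - hr) ^+ 2 = (hr - hl) ^+ 2); last by ring.
rewrite (mulrAC 5 hr hl); ring.
Qed.

Lemma laplace3Z (k : R[i]) hl hr fl fc fr :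
  laplace3 hl hr (k * fl) (k * fc) (k * fr) = k * laplace3 hl hr fl fc fr.
Proof. rewrite /laplace3; ring. Qed.

Lemma numerov3Z (k : R[i]) hl hr fl fc fr :
  numerov3 hl hr (k * fl) (k * fc) (k * fr) = k * numerov3 hl hr fl fc fr.
Proof. rewrite /numerov3; ring. Qed.

Lemma laplace3N hl hr fl fc fr :
  laplace3 hl hr (- fl) (- fc) (- fr) = - laplace3 hl hr fl fc fr.
Proof. by rewrite -[RHS]mulN1r -laplace3Z !mulN1r. Qed.

Lemma numerov3N hl hr fl fc fr :
  numerov3 hl hr (- fl) (- fc) (- fr) = - numerov3 hl hr fl fc fr.
Proof. by rewrite -[RHS]mulN1r -numerov3Z !mulN1r. Qed.

Lemma laplace3_div c hl hr fl fc fr :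
  laplace3 (hl / c) (hr / c) fl fc fr = (c ^+ 2)%:C * laplace3 hl hr fl fc fr.
Proof.
rewrite /laplace3 -mulrDl mulrAC invfM invrK.
rewrite !(rmorphM, rmorphXn, fmorphV) /= !invfM !invrK; ring.
Qed.

(** The coefficients depend only on ratios of steps, whereas [laplace3] has degree -2 in the steps;
    hence the factor [K ^ 2] on the eigenvalue. *)
Lemma numerov3_div c hl hr fl fc fr : c != 0 ->
  numerov3 (hl / c) (hr / c) fl fc fr = numerov3 hl hr fl fc fr.
Proof.
move=> c0.
have E p u v : (p / c) ^+ 2 / (u / c * (v / c)) = p ^+ 2 / (u * v).
  have -> : (p / c) ^+ 2 / (u / c * (v / c)) =
            (c / c) ^+ 2 * (p ^+ 2 / (u * v)) by rewrite !invfM !invrK; ring.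
  by rewrite divff// expr1n mul1r.
by rewrite /numerov3 -mulrDl -mulrBl (mulrA 5) (mulrAC (_ + _)) !E.
Qed.

Lemma laplace3_odd h f : laplace3 h h f 0 (- f) = 0.
Proof. rewrite /laplace3; ring. Qed.

Lemma numerov3_odd h f : numerov3 h h f 0 (- f) = 0.
Proof. rewrite /numerov3; ring. Qed.

End ThreePoint.

(** * Mesh functions vanishing at the end nodes *)

Section MeshFunctions.
Variables (R : realType) (N : nat).
Implicit Types (w : Hh R N) (f : nat -> R[i]).

Lemma at_nodeD w w' j : at_node (w + w') j = at_node w j + at_node w' j.
Proof. by rewrite /at_node mxE. Qed.

Lemma at_nodeZ (c : R[i]) w j : at_node (c *: w) j = c * at_node w j.
Proof. by rewrite /at_node mxE. Qed.

Lemma at_node0 w : at_node w 0 = 0.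
Proof.
have /andP[/eqP w0 _] := Hh_valP w.
by rewrite /at_node (_ : inord 0 = ord0)//; apply: val_inj; rewrite /= inordK.
Qed.

Lemma at_nodeN w : at_node w N = 0.
Proof.
have /andP[_ /eqP wN] := Hh_valP w.
by rewrite /at_node (_ : inord N = ord_max)//; apply: val_inj; rewrite /= inordK.
Qed.

Lemma at_node_eq0 w : (forall j, (j < N)%N -> at_node w j = 0) -> w = 0.
Proof.
move=> w0; apply/val_inj/rowP => j; rewrite [RHS]mxE.
have -> : Hh_val w ord0 j = at_node w j by rewrite /at_node inord_val.
have : (j <= N)%N by rewrite -ltnS.
by rewrite leq_eqVlt => /predU1P[->|/w0//]; exact: at_nodeN.
Qed.

Lemma Hh_of_fun_subproof f :
  \row_(j < N.+1) (if (0 < j < N)%N then f j else 0) \in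
    @vanishing_ends R N.
Proof. by rewrite inE !mxE /= ltnn andbF eqxx. Qed.

Definition Hh_of_fun f : Hh R N := MkHh (Hh_of_fun_subproof f).

Lemma at_node_of_fun f j : (0 < j < N)%N -> at_node (Hh_of_fun f) j = f j.
Proof.
move=> jN; rewrite /at_node mxE inordK ?jN//.
by case/andP: jN => _ /ltnW; rewrite -ltnS.
Qed.

Lemma LambdaZ (x : nat -> R) (c : R[i]) w j :
  Lambda x (c *: w) j = c * Lambda x w j.
Proof. by rewrite !LambdaE !at_nodeZ laplace3Z. Qed.

Lemma sNZ (x : nat -> R) (c : R[i]) w j : sN x (c *: w) j = c * sN x w j.
Proof. by rewrite !sNE !at_nodeZ numerov3Z. Qed.

Lemma implicit_opZ (a tau : R) (x : nat -> R) (c : R[i]) w j :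
  implicit_op a tau x (c *: w) j = c * implicit_op a tau x w j.
Proof. by rewrite /implicit_op LambdaZ sNZ; ring. Qed.

End MeshFunctions.

(** * Transfer of eigenfunctions to the refined mesh *)

Section Refinement.
Variables (R : realType) (X : R) (N0 : nat) (x0 : nat -> R) (K : nat).
Hypotheses (N0_gt0 : (0 < N0)%N) (K_gt0 : (0 < K)%N) (x0_mesh : is_mesh X N0 x0).

Let Kneq0 : K%:R != 0 :> R. Proof. by rewrite pnatr_eq0 -lt0n. Qed.

(* The formula of a block extends to its right end l = N0, where it agrees
   with the one of the next block. *)
Lemma refined_mesh_block q l : (q < K)%N -> (l <= N0)%N ->
  refined_mesh X N0 x0 K (q * N0 + l) =
  if odd q then q.+1%:R * (X / K%:R) - x0 (N0 - l)%N / K%:R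
  else q%:R * (X / K%:R) + x0 l / K%:R.
Proof.
case: x0_mesh => x00 x0N _.
have inner p k : (p < K)%N -> (k < N0)%N ->
    refined_mesh X N0 x0 K (p * N0 + k) =
    if odd p then p.+1%:R * (X / K%:R) - x0 (N0 - k)%N / K%:R
    else p%:R * (X / K%:R) + x0 k / K%:R.
  move=> pK kN; rewrite /refined_mesh divnMDl// divn_small// addn0.
  rewrite modnMDl modn_small// ifF//; apply/negbTE; rewrite neq_ltn.
  by apply/orP; left; nia.
move=> qK; rewrite leq_eqVlt => /predU1P[->|lN]; last exact: inner.
(* The right end of the last block is the node [N0 * K], set to [X] by a separate case of the
   definition; any other block is followed by one of opposite parity. *)
have [qK1|] := eqVneq q.+1 K.
  rewrite {1}/refined_mesh ifT; last by rewrite -qK1; apply/eqP; lia.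
  rewrite subnn x00 x0N mul0r subr0.
  rewrite (_ : q%:R * (X / K%:R) + X / K%:R = q.+1%:R * (X / K%:R)).
    by rewrite if_same qK1 mulrC divfK.
  by rewrite -natr1; ring.
move=> qK1; have qK' : (q.+1 < K)%N by rewrite ltn_neqAle qK1.
rewrite addnC -mulSn -[(q.+1 * N0)%N]addn0 inner//= subnn subn0 x00 x0N.
by case: (odd q) => /=; rewrite -!natr1; ring.
Qed.

Definition odd_extension (f : nat -> R[i]) (j : nat) : R[i] :=
  if odd (j %/ N0) then - f (N0 - j %% N0)%N else f (j %% N0)%N.

(** The right end [l = N0] is included because both neighbouring blocks give 0 there, [f] vanishing
    at 0 and at [N0]. *)
Lemma odd_extension_block (f : nat -> R[i]) q l : f 0%N = 0 -> f N0 = 0 ->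
  (l <= N0)%N ->
  odd_extension f (q * N0 + l) = if odd q then - f (N0 - l)%N else f l.
Proof.
move=> f0 fN; rewrite leq_eqVlt => /predU1P[->|lN].
  rewrite /odd_extension addnC -mulSn mulnK// modnMl subn0 subnn f0 fN oppr0.
  by rewrite !if_same.
by rewrite /odd_extension divnMDl// divn_small// addn0 modnMDl modn_small.
Qed.

Lemma odd_extension_three_point (f : nat -> R[i]) (lambda : R[i]) j :
  let y := refined_mesh X N0 x0 K in let g := odd_extension f in
  f 0%N = 0 -> f N0 = 0 ->
  (forall i, (0 < i < N0)%N ->
     - laplace3 (step x0 i) (step x0 i.+1) (f i.-1) (f i) (f i.+1) =
     lambda *
       numerov3 (step x0 i) (step x0 i.+1) (f i.-1) (f i) (f i.+1)) ->
  (0 < j < N0 * K)%N ->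
  - laplace3 (step y j) (step y j.+1) (g j.-1) (g j) (g j.+1) =
  (K%:R ^+ 2)%:C * lambda *
    numerov3 (step y j) (step y j.+1) (g j.-1) (g j) (g j.+1).
Proof.
move=> y g f0 fN feq /andP[j0 jNK].
pose q := (j %/ N0)%N; pose l := (j %% N0)%N.
have jE : j = (q * N0 + l)%N by exact: divn_eq.
have lN : (l < N0)%N by rewrite ltn_mod.
have qK : (q < K)%N by rewrite ltn_divLR// mulnC.
clearbody q l.
have [l0|l0] := posnP l.
  case: q => [|p] in jE qK *; first by rewrite jE l0 in j0.
  have pK : (p < K)%N by exact: ltnW.
  (* At a junction, [j] is read as the last node of block [p] on its left and as the first node of
     block [p.+1] on its right, so that each step lies in one block. *)
  have j1 : j.-1 = (p * N0 + N0.-1)%N by lia.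
  have j2 : j = (p * N0 + N0)%N by lia.
  have j3 : j.+1 = (p.+1 * N0 + 1)%N by lia.
  have N1 : (N0 - N0.-1 = 1)%N by lia.
  have gj : g j = 0.
    by rewrite j2 /g odd_extension_block// subnn f0 fN oppr0 if_same.
  have gS : g j.+1 = - g j.-1.
    rewrite j3 j1 /g !odd_extension_block ?leq_pred//= N1 subn1.
    by case: (odd p); rewrite /= ?opprK.
  have sS : step y j.+1 = step y j.
    rewrite /step /= j3 j1 {1}jE l0 j2 /y !refined_mesh_block ?leq_pred//=.
    by rewrite N1 subnn subn0 subn1; case: (odd p) => /=; ring.
  by rewrite gj gS sS laplace3_odd numerov3_odd mulr0 oppr0.
have j1 : j.-1 = (q * N0 + l.-1)%N by lia.
have j3 : j.+1 = (q * N0 + l.+1)%N by lia.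
have l1 : (l.-1 <= N0)%N by lia.
have H1 : (N0 - l.-1 = (N0 - l).+1)%N by lia.
have H3 : (N0 - l.+1 = (N0 - l).-1)%N by lia.
rewrite /step /= j3 j1 jE /y /g !refined_mesh_block ?(ltnW lN)//.
rewrite !odd_extension_block ?(ltnW lN)//= H1 H3.
case: (odd q).
  (* In an odd block the node [l] is the image of the node [m] of the initial mesh, with its two
     neighbours exchanged and the sign of [f] changed. *)
  set m := (N0 - l)%N; have mN : (0 < m < N0)%N by rewrite /m; lia.
  have -> : q.+1%:R * (X / K%:R) - x0 m / K%:R -
      (q.+1%:R * (X / K%:R) - x0 m.+1 / K%:R) = step x0 m.+1 / K%:R.
    by rewrite /step /=; ring.
  have -> : q.+1%:R * (X / K%:R) - x0 m.-1 / K%:R -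
      (q.+1%:R * (X / K%:R) - x0 m / K%:R) = step x0 m / K%:R.
    by rewrite /step /=; ring.
  rewrite laplace3_div numerov3_div// laplace3N numerov3N laplace3_swap.
  by rewrite numerov3_swap !mulrN -mulrA -feq// mulrN.
have -> : q%:R * (X / K%:R) + x0 l / K%:R -
    (q%:R * (X / K%:R) + x0 l.-1 / K%:R) = step x0 l / K%:R.
  by rewrite /step /=; ring.
have -> : q%:R * (X / K%:R) + x0 l.+1 / K%:R -
    (q%:R * (X / K%:R) + x0 l / K%:R) = step x0 l.+1 / K%:R.
  by rewrite /step /=; ring.
by rewrite laplace3_div numerov3_div// -mulrA -feq ?l0// mulrN.
Qed.

Lemma is_eigenvalue_refined (lambda : R[i]) : is_eigenvalue x0 N0 lambda ->
  is_eigenvalue (refined_mesh X N0 x0 K) (N0 * K) ((K%:R ^+ 2)%:C * lambda).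
Proof.
case=> e e0 eE; pose g := odd_extension (at_node e).
(* The extension already vanishes at both ends, so [Hh_of_fun] does not alter it. *)
have gE j : (j <= N0 * K)%N -> at_node (Hh_of_fun (N0 * K) g) j = g j.
  have [->|j0] := posnP j.
    by rewrite at_node0 /g /odd_extension div0n mod0n /= at_node0.
  rewrite leq_eqVlt => /predU1P[->|jN]; last by rewrite at_node_of_fun ?j0.
  rewrite at_nodeN /g /odd_extension modnMr subn0 at_node0 at_nodeN oppr0.
  by rewrite if_same.
exists (Hh_of_fun (N0 * K) g).
  (* Block 0 carries [e] itself. *)
  apply: contraNneq e0 => g0; apply/eqP/at_node_eq0 => j jN.
  have : g j = 0 by rewrite -gE ?g0 /at_node ?mxE//; nia.
  by rewrite /g /odd_extension divn_small// modn_small.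
move=> j jN; rewrite LambdaE sNE !gE; [|lia..].
apply: odd_extension_three_point => //; first exact: at_node0.
exact: at_nodeN.
Qed.

End Refinement.

(** * Normal modes of the scheme and their growth *)

Section NormalModes.
Variables (R : realType) (a tau : R) (x : nat -> R) (N : nat).
Hypothesis tau_neq0 : tau != 0.

(* The relation on q is the characteristic equation of the three-level recurrence,
   multiplied by 1 + z / 12. *)
Lemma is_solution_geometric (e : Hh R N) (lambda q : R[i]) :
  let z := (tau ^+ 2 * a ^+ 2)%:C * lambda in
  (forall j, (0 < j < N)%N -> - Lambda x e j = lambda * sN x e j) ->
  (1 + z / 12) * (q ^+ 2 - 2 * q + 1) + z * q = 0 ->
  exists u1, is_solution a tau x e u1 (fun m => q ^+ m *: e).
Proof.
move=> z eE qE.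
(* The data [u1] is free: it is taken to be whatever the initial equation requires, so that equation
   puts no condition on [q]. *)
pose u j := implicit_op a tau x (tau^-1%:C *: (q ^+ 1 *: e - q ^+ 0 *: e)) j
            - (tau / 2 * a ^+ 2)%:C * Lambda x (q ^+ 0 *: e) j.
exists (Hh_of_fun N u); split => [|m j m0 jN|j jN].
- by rewrite expr0 scale1r.
- case: m m0 => // m _ /=.
  have -> : q ^+ m.+2 *: e - 2 *: (q ^+ m.+1 *: e) + q ^+ m *: e =
            (q ^+ m * (q ^+ 2 - 2 * q + 1)) *: e.
    rewrite scalerA -scalerBl -scalerDl; congr (_ *: _).
    by rewrite !exprS; ring.
  (* With [Lambda] eliminated by the eigenvalue equation, every term becomes a multiple of
     [sN x e j]. *)
  have LE : Lambda x e j = - (lambda * sN x e j) by rewrite -eE// opprK.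
  rewrite implicit_opZ implicit_opZ LambdaZ /implicit_op LE.
  have -> : (a ^+ 2)%:C = (tau ^+ 2)^-1%:C * (tau ^+ 2 * a ^+ 2)%:C :> R[i].
    by rewrite -rmorphM /= mulKf// expf_neq0.
  have sE : (sigma R * tau ^+ 2 * a ^+ 2)%:C = (tau ^+ 2 * a ^+ 2)%:C / 12 :> R[i].
    by rewrite /sigma -mulrA rmorphM fmorphV rmorph_nat mulrC.
  rewrite sE.
  transitivity ((tau ^+ 2)^-1%:C * q ^+ m * sN x e j *
     ((1 + z / 12) * (q ^+ 2 - 2 * q + 1) + z * q)); last by rewrite qE mulr0.
  by rewrite /z (exprS q m); ring.
- by rewrite at_node_of_fun.
Qed.

End NormalModes.

(** If [p > rho], Bernoulli's inequality makes [(p / rho) ^ m] grow at least linearly in [m], while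
    the bound keeps it below [B / A]. *)
Lemma le_of_geometric_bound (R : realType) (p rho A B : R) :
  0 < A -> 0 <= p -> 1 <= rho ->
  (forall m : nat, p ^+ m * A <= B * rho ^+ m) -> p <= rho.
Proof.
move=> A0 p0 rho1 H; rewrite leNgt; apply/negP => ltp.
have rho0 : 0 < rho by exact: lt_le_trans rho1.
pose s := p / rho - 1; have s0 : 0 < s by rewrite subr_gt0 ltr_pdivlMr ?mul1r.
have bern m : 1 + m%:R * s <= (p / rho) ^+ m.
  elim: m => [|m IH]; first by rewrite mul0r addr0 expr0.
  rewrite exprS; have -> : p / rho = 1 + s by rewrite /s; ring.
  have m0 : 0 <= m%:R * s :> R by rewrite mulr_ge0// ltW.
  have := ler_wpM2l (ltW (addr_gt0 ltr01 s0)) IH.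
  have -> : p / rho = 1 + s by rewrite /s; ring.
  apply: le_trans; rewrite -natr1; nra.
have bnd m : A * (m%:R * s) <= B.
  have rm0 : 0 < rho ^+ m by rewrite exprn_gt0.
  have : (p / rho) ^+ m * A <= B.
    by rewrite expr_div_n mulrAC ler_pdivrMr// H.
  apply: le_trans; rewrite mulrC ler_pM2r//; apply: le_trans (bern m).
  by rewrite lerDr.
have As0 : 0 < A * s by exact: mulr_gt0.
have [m Hm] : exists m : nat, B / (A * s) < m%:R.
  exists (Num.truncn (B / (A * s))).+1; exact: truncnS_gt.
have := bnd m; rewrite mulrCA -ler_pdivlMr// => /(lt_le_trans Hm).
by rewrite ltxx.
Qed.

(** The mode [q ^ m e] has norm [|q| ^ m] times that of [e]. The constant [C] and the norms enter
    only a factor independent of [m], so they do not affect the rate. *)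
Lemma stability_bound_mode (R : realType) (a tau kappa C : R) (x : nat -> R)
    (N : nat) (norm_h norm_1h : Hh R N -> R) (e : Hh R N) (lambda q : R[i]) :
  let z := (tau ^+ 2 * a ^+ 2)%:C * lambda in
  0 < tau -> 0 <= kappa -> is_norm norm_h -> e != 0 ->
  (forall j, (0 < j < N)%N -> - Lambda x e j = lambda * sN x e j) ->
  (1 + z / 12) * (q ^+ 2 - 2 * q + 1) + z * q = 0 ->
  stability_bound a tau kappa x norm_h norm_1h C ->
  `|q| <= (1 + kappa * tau)%:C.
Proof.
move=> z tau0 kappa0 [n0 n_eq0 nZ _] e0 eE qE stab.
have [u1 sol] := is_solution_geometric (lt0r_neq0 tau0) eE qE.
(* The modulus on [R[i]] is itself an element of [R[i]]; [p] is its real value. *)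
have [p pE] : exists p : R, `|q| = p%:C by rewrite normc_def; eexists.
have p0 : 0 <= p by rewrite -lecR -pE normr_ge0.
rewrite pE lecR.
apply: (@le_of_geometric_bound _ p _ (norm_h e)
          (C * (norm_h e + norm_1h u1))) => //.
- by rewrite lt_neqAle n0 andbT eq_sym; apply: contra_neq e0 => /n_eq0.
- by rewrite lerDl mulr_ge0// ltW.
move=> m; rewrite mulrAC; have := stab _ _ _ sol m.
suff -> : norm_h (q ^+ m *: e) = p ^+ m * norm_h e by [].
by apply: complexI; rewrite nZ normrX pE rmorphM rmorphXn.
Qed.

(** * Imaginary part of z from bounds on the two roots *)

Lemma Im_symbol_bound (R : realType) (z q q' : R[i]) (t : R) :
  0 <= t <= 1 -> q * q' = 1 -> (z + 12) * (10 + (q + q')) = 144 ->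
  `|q| <= (1 + t)%:C -> `|q'| <= (1 + t)%:C ->
  `|complex.Im z| <= 9 / 2 * (t + t ^+ 2).
Proof.
move=> /andP[t0 t1].
have natC n : n%:R = (n%:R : R) +i* 0 :> R[i].
  by rewrite -[LHS](rmorph_nat (real_complex R)).
case: q => [x y]; case: q' => [u v]; case: z => [zr zi] /=.
rewrite !normc_def /= !lecR !natC => -[E1 E2] [F1 F2].
set n := Num.sqrt _; set n' := Num.sqrt _ => Hn Hn'.
have nn : n ^+ 2 = x ^+ 2 + y ^+ 2.
  by rewrite sqr_sqrtr// addr_ge0 ?sqr_ge0.
have nn' : n' ^+ 2 = u ^+ 2 + v ^+ 2.
  by rewrite sqr_sqrtr// addr_ge0 ?sqr_ge0.
have n0 : 0 <= n by exact: sqrtr_ge0.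
have n'0 : 0 <= n' by exact: sqrtr_ge0.
clearbody n n'.
have P1 : n * n' = 1.
  have /eqP : (n * n') ^+ 2 = 1 ^+ 2.
    rewrite exprMn nn nn' expr1n.
    transitivity ((x * u - y * v) ^+ 2 + (x * v + y * u) ^+ 2); first by ring.
    by rewrite E1 E2 expr1n expr0n addr0.
  by rewrite eqrXn2 ?mulr_ge0// => /eqP.
(* Expanding [(1 + t - n) (1 + t - n') >= 0] with [n n' = 1] gives
   [(1 + t) (n + n') <= 2 + 2 t + t^2]. *)
have sum_le : n + n' <= 2 + t ^+ 2.
  have : (1 + t) * (n + n') <= (1 + t) * (2 + t ^+ 2) by nra.
  by rewrite ler_pM2l//; lra.
have n'_ge : 1 - t <= n' by nra.
have n_ge : 1 - t <= n by nra.
(* In real and imaginary parts, [q'] is the conjugate of [q] times [|q'|^2]. *)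
have u_eq : u = x * n' ^+ 2.
  rewrite nn'; transitivity (u * (x * u - y * v) + v * (x * v + y * u)).
    by rewrite E1 E2; ring.
  by ring.
have v_eq : v = - y * n' ^+ 2.
  rewrite nn'; transitivity (v * (x * u - y * v) - u * (x * v + y * u)).
    by rewrite E1 E2; ring.
  by ring.
have x_le : `|x| <= n.
  by rewrite -ler_sqr ?nnegrE// real_normK ?num_real// nn lerDl sqr_ge0.
have y_le : `|y| <= n.
  by rewrite -ler_sqr ?nnegrE// real_normK ?num_real// nn lerDr sqr_ge0.
have u_le : `|u| <= n'.
  by rewrite -ler_sqr ?nnegrE// real_normK ?num_real// nn' lerDl sqr_ge0.
(* Since [|y| <= n], the left side is at most [|n - n'|], and both moduli lie between [1 - t] and
   [1 + t]. *)
have w_im : `|y + v| <= 2 * t.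
  have -> : y + v = y * (1 - n' ^+ 2) by rewrite v_eq; ring.
  rewrite normrM; apply: (@le_trans _ _ (n * `|1 - n' ^+ 2|)).
    by rewrite ler_wpM2r.
  rewrite -[X in X * _](ger0_norm n0) -normrM.
  have -> : n * (1 - n' ^+ 2) = n - n' by rewrite mulrBr expr2 mulrA P1; ring.
  by rewrite ler_norml; apply/andP; split; lra.
have w_re : - (2 + t ^+ 2) <= x + u.
  move: x_le u_le; rewrite !ler_norml => /andP[? _] /andP[? _]; lra.
(* [D] is [|10 + q + q'|^2], the denominator of the imaginary part of [144 / (10 + q + q')]. *)
set D := (10 + (x + u)) ^+ 2 + (y + v) ^+ 2.
have z_im : zi * D = - 144 * (y + v).
  transitivity ((10 + (x + u)) * ((zr + 12) * (0 + (y + v)) + (zi + 0) * (10 + (x + u)))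
     - (y + v) * ((zr + 12) * (10 + (x + u)) - (zi + 0) * (0 + (y + v)))).
    by rewrite /D; ring.
  by rewrite F1 F2; ring.
have D_ge : 64 - 16 * t ^+ 2 <= D.
  have : (8 - t ^+ 2) ^+ 2 <= (10 + (x + u)) ^+ 2 by rewrite ler_sqr ?nnegrE; nra.
  by have := sqr_ge0 (y + v); rewrite /D; have := sqr_ge0 (t ^+ 2); nra.
have G0 : 0 < 64 - 16 * t ^+ 2 by nra.
rewrite -(ler_pM2r G0); apply: (@le_trans _ _ (`|zi| * D)).
  by rewrite ler_wpM2l.
rewrite -[X in `|zi| * X]ger0_norm ?(le_trans (ltW G0))//.
rewrite -normrM z_im normrM normrN [`|144|]ger0_norm//.
apply: (@le_trans _ _ (144 * (2 * t))); first by rewrite ler_wpM2l.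
(* As [288 / 64 = 9 / 2], what remains is [64 t^2 - 16 t^3 - 16 t^4 >= 0], a consequence of
   [t^4 <= t^3 <= t^2]. *)
have : 0 <= t * (t * (1 - t)) by rewrite !mulr_ge0// subr_ge0.
have : 0 <= t ^+ 2 * (t * (1 - t)) by rewrite !mulr_ge0 ?sqr_ge0// subr_ge0.
nra.
Qed.

(** Quadratic formula for [p^2 - w p + 1], with a complex square root of the discriminant. *)
Lemma reciprocal_roots (R : realType) (w : R[i]) :
  exists q q' : R[i], q + q' = w /\ q * q' = 1.
Proof.
pose d := sqrtc (w ^+ 2 - 4).
have dd : d ^+ 2 = w ^+ 2 - 4 by exact: sqr_sqrtc.
exists ((w + d) / 2), ((w - d) / 2); split; first by field.
have -> : (w + d) / 2 * ((w - d) / 2) = (w ^+ 2 - d ^+ 2) / 4 by field.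
by rewrite dd; field.
Qed.

Lemma stability_bound_Im (R : realType) (a tau kappa C : R) (x : nat -> R)
    (N : nat) (norm_h norm_1h : Hh R N -> R) (lambda : R[i]) :
  0 < tau -> 0 <= kappa -> kappa * tau <= 1 -> is_norm norm_h ->
  is_eigenvalue x N lambda ->
  stability_bound a tau kappa x norm_h norm_1h C ->
  tau ^+ 2 * a ^+ 2 * `|complex.Im lambda| <=
  9 / 2 * (kappa * tau + (kappa * tau) ^+ 2).
Proof.
move=> tau0 kappa0 kt1 nh [e e0 eE] stab.
have kt0 : 0 <= kappa * tau by rewrite mulr_ge0// ltW.
pose z := (tau ^+ 2 * a ^+ 2)%:C * lambda.
have -> : tau ^+ 2 * a ^+ 2 * `|complex.Im lambda| = `|complex.Im z|.
  have -> : complex.Im z = tau ^+ 2 * a ^+ 2 * complex.Im lambda.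
    by rewrite /z; case: (lambda) => lr li /=; rewrite mul0r addr0.
  by rewrite normrM [`|tau ^+ 2 * _|]ger0_norm// mulr_ge0 ?sqr_ge0.
(* For [z = -12] the leading coefficient [1 + z / 12] vanishes and the pair of roots is lost, but
   then [z] is real. *)
have [z12|z12] := eqVneq (z + 12) 0.
  have -> : complex.Im z = 0.
    have -> : z = (- 12)%:C by rewrite rmorphN rmorph_nat; apply/eqP; rewrite -addr_eq0 z12.
    by [].
  by rewrite normr0 mulr_ge0// addr_ge0 ?sqr_ge0.
have [q [q' [qD qM]]] := reciprocal_roots (144 / (z + 12) - 10).
(* The characteristic equation is this quadratic times [(z + 12) / 12]; both reciprocal roots
   satisfy it, so the mode bound applies to each. *)
have char p : p ^+ 2 - (144 / (z + 12) - 10) * p + 1 = 0 ->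
    (1 + z / 12) * (p ^+ 2 - 2 * p + 1) + z * p = 0.
  move=> pE; rewrite -[RHS](mulr0 ((z + 12) / 12)) -pE; field.
  by rewrite z12.
apply: (@Im_symbol_bound _ _ q q'); rewrite ?kt0//.
- by rewrite qD [10 + _]addrC subrK mulrC divfK.
- apply: (stability_bound_mode tau0 kappa0 nh e0 eE _ stab); apply: char.
  by rewrite -qD -qM; ring.
- apply: (stability_bound_mode tau0 kappa0 nh e0 eE _ stab); apply: char.
  by rewrite -qD -qM; ring.
Qed.

Theorem corollary2 (R : realType) :
  exists r : R -> R -> R, forall kappa : R, 0 <= kappa ->
    (r kappa : R -> R^o) =O_ (0^'+ : set_system R) (id : R -> R^o) /\
    \forall tau \near 0^'+,
      forall (a X : R) (N0 : nat) (x0 : nat -> R) (lambda0 : R[i]),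
        0 < a -> 0 < X -> (2 <= N0)%N -> is_mesh X N0 x0 ->
        is_eigenvalue x0 N0 lambda0 ->
      forall (K : nat), (1 <= K)%N ->
      forall (norm_h norm_1h : Hh R (N0 * K) -> R),
        is_norm norm_h -> is_norm norm_1h ->
      forall C : R, 0 < C ->
        stability_bound a tau kappa (refined_mesh X N0 x0 K) norm_h norm_1h C ->
        a ^+ 2 * `|complex.Im lambda0| * mean_step X N0 ^+ 2
          * (tau / mean_step X (N0 * K) ^+ 2)
        <= 9 / 2 * kappa + r kappa tau.
Proof.
(* This is the term [9 / 2 * (kappa * tau) ^ 2] of the bound divided by [tau]. *)
exists (fun kappa tau => 9 / 2 * kappa ^+ 2 * tau) => kappa kappa0; split.
  apply/eqOP; near=> k.
  have k_ge : `|9 / 2 * kappa ^+ 2| <= k.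
    by near: k; apply: nbhs_pinfty_ge; rewrite num_real.
  by near=> tau; rewrite normrM; exact: ler_wpM2r.
(* The threshold [1 / (kappa + 1)] for [tau] gives [kappa * tau <= 1], covers [kappa = 0], and
   depends on [kappa] alone. *)
have k0 : 0 < kappa + 1 by lra.
near=> tau => a X N0 x0 lambda0 a0 X0 N02 x0_mesh eig K K1 norm_h norm_1h
  nh _ C _ stab.
have tau0 : 0 < tau by near: tau; exact: nbhs_right_gt.
have kt1 : kappa * tau <= 1.
  have : tau <= (kappa + 1)^-1.
    by near: tau; apply: nbhs_right_le; rewrite invr_gt0.
  rewrite -[_^-1]mul1r ler_pdivlMr//; nra.
have N0gt0 : (0 < N0)%N by exact: leq_trans N02.
have := stability_bound_Im tau0 kappa0 kt1 nh
  (is_eigenvalue_refined N0gt0 K1 x0_mesh eig) stab.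
have -> : complex.Im ((K%:R ^+ 2)%:C * lambda0) = K%:R ^+ 2 * complex.Im lambda0.
  by case: (lambda0) => lr li /=; rewrite mul0r addr0.
rewrite normrM ger0_norm ?sqr_ge0// => H.
rewrite -(ler_pM2r tau0) /mean_step natrM.
have X0' : X != 0 by rewrite gt_eqF.
have N0' : N0%:R != 0 :> R by rewrite pnatr_eq0 -lt0n.
have K' : K%:R != 0 :> R by rewrite pnatr_eq0 -lt0n.
(* The squared ratio of the mean steps is [K ^ 2], the factor between the two eigenvalues. *)
have -> : a ^+ 2 * `|complex.Im lambda0| * (X / N0%:R) ^+ 2
   * (tau / (X / (N0%:R * K%:R)) ^+ 2) * tau
   = tau ^+ 2 * a ^+ 2 * (K%:R ^+ 2 * `|complex.Im lambda0|).
  by field; rewrite X0' N0' K'.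
by apply: le_trans H _; rewrite le_eqVlt; apply/orP; left; apply/eqP; ring.
Unshelve. all: by end_near.
Qed.
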